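(* Let $q\geq3$ and $n\geq N(q)+q$ be integers, and put $h=n-N(q)-q+1$. Then \[ C(n)\geq h\,\frac{(q-1)(q-2)}2,\qquad D(n)\geq h(2q-5), \] and \[ T(n,k)\geq h(2q-4k+3) \] for every integer $k$ with $2\leq k\leq\lceil q/2\rceil$. Moreover, \[ \mu(n)\geq\left\lceil\frac q2\right\rceil. \]
   Context: For an integer $n\geq1$, $\mathcal{M}_n$ is the set (repeated values counted once) of all multinomial coefficient values $\frac{n!}{p_1!\cdots p_t!}$, where $(p_1,\ldots,p_t)$ ranges over all integer partitions of $n$ ($p_1\geq\cdots\geq p_t\geq1$, $p_1+\cdots+p_t=n$). For an integer $t$, $r_n(t)=\#\{(x,y):x,y\in\mathcal{M}_n,\ x\leq y,\ x+y=t\}$. Define $C(n)=\sum_t\max(r_n(t)-1,0)$, $D(n)=\#\{t:r_n(t)\geq2\}$, $\mu(n)=\max_t r_n(t)$, and $T(n,k)=\#\{t:r_n(t)\geq k\}$ for $k\geq2$. For an integer $q\geq2$, \[ N(q)=\sum_{\substack{p\leq q\\ p\ \mathrm{prime}}}p\left\lfloor\frac{\log q}{\log p}\right\rfloor , \] where $\lfloor\log q/\log p\rfloor$ is the largest $e$ with $p^e\leq q$. *)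

(* Defs.v *)
From mathcomp Require Import all_boot.
From mathcomp Require Import finmap.

Set Implicit Arguments.
Unset Strict Implicit.
Unset Printing Implicit Defensive.

Local Open Scope fset_scope.
Local Open Scope nat_scope.

Definition is_partition (n : nat) (p : seq nat) : bool :=
  [&& sorted geq p, all (leq 1) p & sumn p == n].

(* A partition of n has at most n parts, each at most n; [mem_partitions]
   shows that no partition is lost by this bounded enumeration. *)
Definition partitions (n : nat) : seq (seq nat) :=
  [seq p <- [seq map val (tval s)
            | k <- iota 0 n.+1, s <- enum {: k.-tuple 'I_n.+1}]
  | is_partition n p].

(* The division is exact, see [dvdn_prod_fact]. *)
Definition multinomial (n : nat) (p : seq nat) : nat :=
  n`! %/ \prod_(i <- p) i`!.

Definition multinomials (n : nat) : {fset nat} :=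
  [fset multinomial n p | p in partitions n].

Definition r (n t : nat) : nat :=
  #|` [fset xy in multinomials n `*` multinomials n
      | (xy.1 <= xy.2) && (xy.1 + xy.2 == t)] |.

(* The t with [r n t > 0] all lie in this set ([r_gt0_sums]), so that sums,
   counts (of t with r n t >= k, k >= 1) and maxima over all t may be taken
   over it. *)
Definition sums (n : nat) : {fset nat} :=
  [fset x + y | x in multinomials n, y in multinomials n].

(* Truncated subtraction: [r n t - 1] is max(r_n(t) - 1, 0). *)
Definition C (n : nat) : nat := \sum_(t <- sums n) (r n t - 1).

Definition D (n : nat) : nat := #|` [fset t in sums n | 2 <= r n t] |.

Definition mu (n : nat) : nat := \max_(t <- sums n) r n t.

Definition T (n k : nat) : nat := #|` [fset t in sums n | k <= r n t] |.

Definition N (q : nat) : nat := \sum_(p < q.+1 | prime p) p * trunc_log p q.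

Lemma size_le_sumn p : all (leq 1) p -> size p <= sumn p.
Proof.
elim: p => //= x p IH /andP[x1 /IH le_p].
by rewrite -add1n leq_add.
Qed.

Lemma mem_le_sumn p x : x \in p -> x <= sumn p.
Proof.
elim: p => //= y p IH; rewrite inE => /orP[/eqP->|/IH le_x].
  exact: leq_addr.
exact: leq_trans le_x (leq_addl _ _).
Qed.

Lemma mem_partitions n p : (p \in partitions n) = is_partition n p.
Proof.
rewrite mem_filter; case: (boolP (is_partition n p)) => // part_p; rewrite andTb.
have /and3P[_ pos_p /eqP sum_p] := part_p.
have sz : size (map (@inord n) p) == size p by rewrite size_map.
apply/allpairsPdep; exists (size p), (Tuple sz); split.
- by rewrite mem_iota /= add0n ltnS -sum_p size_le_sumn.
- by rewrite mem_enum.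
rewrite -map_comp -[LHS]map_id; apply/eq_in_map => x /mem_le_sumn le_x.
by rewrite /= inordK // ltnS -sum_p.
Qed.

Lemma dvdn_prod_fact p : \prod_(i <- p) i`! %| (sumn p)`!.
Proof.
elim: p => [|x p IH]; first by rewrite big_nil.
rewrite big_cons /= -(bin_fact (leq_addr (sumn p) x)) addKn.
by rewrite dvdn_mull // dvdn_mul.
Qed.

Lemma multinomialsP n x :
  reflect (exists2 p, is_partition n p & x = multinomial n p)
          (x \in multinomials n).
Proof.
apply: (iffP (imfsetP _ _ _ _)) => /= -[p].
  by rewrite mem_partitions; exists p.
by rewrite -mem_partitions; exists p.
Qed.

Lemma r_gt0_sums n t : 0 < r n t -> t \in sums n.
Proof.
rewrite cardfs_gt0 => /fset0Pn[[x y]].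
rewrite !inE /= => /andP[/andP[Mx My] /andP[_ /eqP <-]].
exact: in_imfset2.
Qed.

(* Main.v *)
(** Each prime p <= q contributes trunc_log p q parts equal to p, using up N(q);
    splitting one of them as (p - 1) + 1 multiplies the multinomial coefficient
    by p.  As j <= q divides the product of these primes with multiplicities,
    K j is a multinomial coefficient for all 1 <= j <= q, where K is the
    coefficient with no part split.  Completing the partition by one part s with
    q <= s < q + h and by ones gives h values K_s of K.  The sums of two terms
    of K_s {1, ..., q} are the K_s t with 2 <= t <= 2q, and
    K_s >= (s + 1) K_(s+1) keeps them apart for different s.  What remains is
    to count the pairs in {1, ..., q} with a given sum. *)

Require Import Defs.
From mathcomp Require Import all_boot.
From mathcomp Require Import finmap zify.

Set Implicit Arguments.
Unset Strict Implicit.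
Unset Printing Implicit Defensive.

Local Open Scope fset_scope.
Local Open Scope nat_scope.

(* Zero parts are harmless, since 0! = 1. *)
Lemma mem_multinomials_seq (u : seq nat) :
  (sumn u)`! %/ \prod_(i <- u) i`! \in multinomials (sumn u).
Proof.
set v := sort geq [seq i <- u | 0 < i].
have geq_total : total geq by move=> x y; exact: leq_total.
have pv : perm_eq v [seq i <- u | 0 < i] by rewrite perm_sort.
have sum_v : sumn v = sumn u.
  rewrite (perm_sumn pv) !sumnE big_filter [RHS](bigID (fun i => 0 < i)) /=.
  by rewrite [X in _ + X]big1 ?addn0 // => i; case: i.
apply/multinomialsP; exists v.
  rewrite /is_partition sum_v eqxx andbT sort_sorted //=.
  by apply/allP => i; rewrite (perm_mem pv) mem_filter => /andP[].
rewrite /multinomial (perm_big _ pv) /= big_filter; congr (_ %/ _).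
rewrite (bigID (fun i => 0 < i)) /=.
by rewrite [X in _ * X]big1 ?muln1 // => i; case: i.
Qed.

(* Makes [j] times n! / [b] the multinomial coefficient of [u]. *)
Definition attains (n b j : nat) : Prop :=
  exists2 u : seq nat, sumn u = n & (\prod_(i <- u) i`!) * j = b.

Lemma attains0 : attains 0 1 1.
Proof. by exists [::]; rewrite ?big_nil. Qed.

Lemma attains1 (n : nat) : attains n n`! 1.
Proof. by exists [:: n]; rewrite /= ?addn0 // big_seq1 muln1. Qed.

Lemma attains_split (n : nat) : 0 < n -> attains n n`! n.
Proof.
case: n => // n _; exists [:: n; 1]; first by rewrite /= addn0 addn1.
by rewrite big_cons big_seq1 muln1 mulnC factS.
Qed.

Lemma attainsM (n1 b1 j1 n2 b2 j2 : nat) :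
  attains n1 b1 j1 -> attains n2 b2 j2 ->
  attains (n1 + n2) (b1 * b2) (j1 * j2).
Proof.
move=> [u <- <-] [v <- <-]; exists (u ++ v); first by rewrite sumn_cat.
by rewrite big_cat mulnACA.
Qed.

Lemma attainsX (n b j e : nat) :
  attains n b j -> attains (n * e) (b ^ e) (j ^ e).
Proof.
move=> nbj; elim: e => [|e IHe]; first by rewrite muln0; exact: attains0.
by rewrite mulnS !expnS; apply: attainsM.
Qed.

(** Adjoining n' - n parts equal to 1 leaves the product of factorials unchanged. *)
Lemma attains_pad (n b j n' : nat) :
  n <= n' -> attains n b j -> attains n' b j.
Proof.
move=> le_nn' nbj; have := attainsM nbj (attainsX (n' - n) (attains1 1)).
by rewrite mul1n subnKC // !exp1n !muln1.
Qed.

(** Attaining 1 makes [b] a product of factorials whose arguments sum to [n], hence a divisor of n!.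
    The quotient is then exact and [j] can be moved inside it. *)
Lemma attains_multinomials (n b j : nat) :
  attains n b 1 -> attains n b j -> n`! %/ b * j \in multinomials n.
Proof.
move=> [v sum_v]; rewrite muln1 => def_b [u sum_u pj_b].
have dvd_b : b %| n`! by rewrite -def_b -sum_v dvdn_prod_fact.
have pu_gt0 : 0 < \prod_(i <- u) i`! by apply: prodn_gt0 => i; exact: fact_gt0.
have -> : n`! %/ b * j = n`! %/ \prod_(i <- u) i`!.
  by rewrite -{2}(divnK dvd_b) -{3}pj_b mulnCA mulKn.
by rewrite -sum_u mem_multinomials_seq.
Qed.

Definition base (q : nat) : nat :=
  \prod_(p < q.+1 | prime p) p`! ^ trunc_log p q.

Lemma base_gt0 (q : nat) : 0 < base q.
Proof. by apply: prodn_cond_gt0 => p _; rewrite expn_gt0 fact_gt0. Qed.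

Lemma prod_prime_logn (q j : nat) : 0 < j <= q ->
  \prod_(p < q.+1 | prime p) p ^ logn p j = j.
Proof.
case/andP=> j_gt0 le_jq; rewrite -[RHS](partnT j_gt0) (widen_partn _ le_jq).
rewrite big_mkord big_mkcond; apply: eq_bigr => p _.
by case: ifPn => // /negPf np; rewrite lognE np.
Qed.

Lemma attains_base (q j : nat) : 0 < j <= q -> attains (N q) (base q) j.
Proof.
move=> jq; rewrite -[j in attains _ _ j](prod_prime_logn jq) /N /base.
elim/big_rec3: _ => [|p n b i pr_p IH]; first exact: attains0.
have le_log : logn p j <= trunc_log p q.
  case/andP: jq => j_gt0 le_jq.
  apply: trunc_log_max; first exact: prime_gt1.
  by apply: leq_trans le_jq; rewrite dvdn_leq // pfactor_dvdn.
apply: attainsM IH; set a := logn p j in le_log *.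
(* Of the [trunc_log p q] parts equal to [p], [a] are split and the other [c] stay whole. *)
rewrite -(subnKC le_log) mulnDr expnD; set c := _ - a.
have -> : p ^ a = p ^ a * 1 ^ c by rewrite exp1n muln1.
apply: attainsM; apply: attainsX; last exact: attains1.
exact/attains_split/prime_gt0.
Qed.

(* The K_s of the header. *)
Definition scale (q n s : nat) : nat := n`! %/ (base q * s`!).

Lemma attains_scale (q n s j : nat) : N q + s <= n -> 0 < j <= q ->
  attains n (base q * s`!) j.
Proof.
move=> le_n jq; apply: attains_pad le_n _; rewrite -[j]muln1.
by apply: attainsM (attains1 s); exact: attains_base.
Qed.

Lemma mem_scale (q n s j : nat) : N q + s <= n -> 0 < j <= q ->
  scale q n s * j \in multinomials n.
Proof.
move=> le_n jq; apply: attains_multinomials; apply: attains_scale => //.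
by case/andP: jq => j_gt0 /(leq_trans j_gt0).
Qed.

Lemma scaleK (q n s : nat) : 0 < q -> N q + s <= n ->
  scale q n s * (base q * s`!) = n`!.
Proof.
move=> q_gt0 le_n; apply: divnK.
have [|u <- <-] := attains_scale (j := 1) le_n; first by rewrite q_gt0.
by rewrite muln1 dvdn_prod_fact.
Qed.

Lemma scale_gt0 (q n s : nat) : 0 < q -> N q + s <= n -> 0 < scale q n s.
Proof.
move=> q_gt0 le_n; have := fact_gt0 n; rewrite -(scaleK q_gt0 le_n) muln_gt0.
by case/andP.
Qed.

(** The ratio of the two scales is s'!/s!, a multiple of s + 1. *)
Lemma scale_gap (q n s s' : nat) : 0 < q -> N q + s' <= n -> s < s' ->
  s.+1 * scale q n s' <= scale q n s.
Proof.
move=> q_gt0 le_n lt_ss'.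
have le_n' : N q + s <= n by apply: leq_trans le_n; rewrite leq_add2l ltnW.
have b_gt0 : 0 < base q * s`! by rewrite muln_gt0 base_gt0 fact_gt0.
rewrite -(leq_pmul2r b_gt0) scaleK // -(scaleK q_gt0 le_n).
have -> : s.+1 * scale q n s' * (base q * s`!)
        = scale q n s' * (base q * s.+1`!) by rewrite factS; lia.
rewrite !leq_mul // dvdn_leq ?fact_gt0 //.
by rewrite -(bin_fact lt_ss') dvdn_mull // dvdn_mulr.
Qed.

Lemma scale_inj (q n s s' t t' : nat) :
  0 < q -> N q + s <= n -> N q + s' <= n -> q <= s -> q <= s' ->
  2 <= t <= 2 * q -> 2 <= t' <= 2 * q ->
  scale q n s * t = scale q n s' * t' -> s = s' /\ t = t'.
Proof.
move=> q_gt0.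
wlog le_ss' : s s' t t' / s <= s' => [IH|].
  have [le_ss'|/ltnW le_s's] := leqP s s'; first exact: IH.
  move=> ns ns' qs qs' qt qt' /esym E.
  by have [-> ->] := IH s' s t' t le_s's ns' ns qs' qs qt' qt E.
move=> ns ns' qs _ /andP[t2 _] /andP[_ t'q] E.
have K_gt0 := scale_gt0 q_gt0 ns'.
have [eq_s|ne_s] := eqVneq s s'.
  by split=> //; move/eqP: E; rewrite -eq_s eqn_pmul2l ?eq_s // => /eqP.
have lt_ss' : s < s' by rewrite ltn_neqAle ne_s.
have gap := scale_gap q_gt0 ns' lt_ss'.
have : scale q n s' * t' < scale q n s * t.
  (* Since q <= s, t' <= 2q < 2(s + 1), while t >= 2. *)
  apply: (@leq_trans (s.+1 * scale q n s' * 2)); last exact: leq_mul.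
  nia.
by rewrite E ltnn.
Qed.

(* The number of pairs x <= y in {1, ..., q} with x + y = t, when 2 <= t <= 2q:
   x ranges over the integers from max(1, t - q) to t / 2. *)
Definition pairs (q t : nat) : nat := (t./2).+1 - maxn 1 (t - q).

(** Scaling by K_s turns pairs from {1, ..., q} into pairs of multinomial coefficients. Other
    coefficients may give the same sum, hence only an inequality. *)
Lemma pairs_le_r (q n s t : nat) : 0 < q -> N q + s <= n ->
  pairs q t <= r n (scale q n s * t).
Proof.
move=> q_gt0 le_n; have K_gt0 := scale_gt0 q_gt0 le_n.
set K := scale q n s in K_gt0 *; set a := maxn 1 (t - q).
pose l := [seq (K * x, K * (t - x)) | x <- iota a (pairs q t)].
have -> : pairs q t = size l by rewrite size_map size_iota.
apply: uniq_leq_size.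
  rewrite map_inj_uniq ?iota_uniq // => x y [/eqP].
  by rewrite eqn_pmul2l // => /eqP.
move=> _ /mapP[x /[!mem_iota] xP ->].
have {xP} [x_gt0 le_x le_q le_xq] :
    [/\ 0 < x, x <= t - x, t - x <= q & x <= q] by rewrite /pairs /a in xP; split; lia.
have Mx : K * x \in multinomials n by apply: mem_scale; rewrite ?x_gt0.
have My : K * (t - x) \in multinomials n.
  by apply: mem_scale; rewrite ?le_q ?andbT // (leq_trans x_gt0).
rewrite !inE /= Mx My leq_mul2l le_x orbT -mulnDr subnKC //=.
exact: leq_trans le_x (leq_subr _ _).
Qed.

Lemma pairs_gt0 (q t : nat) : 2 <= t <= 2 * q -> 0 < pairs q t.
Proof. by rewrite /pairs; lia. Qed.

Lemma sum_pairs (q : nat) : 0 < q ->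
  \sum_(2 <= t < (2 * q).+1) (pairs q t - 1) = ((q - 1) * (q - 2)) %/ 2.
Proof.
case: q => // q _; elim: q => [|q IHq]; first by rewrite big_nat1.
have -> : (2 * q.+2).+1 = (2 * q.+1).+3 by lia.
do 2![rewrite big_nat_recr; last lia].
(* The two largest sums have one pair each, so they contribute 0. *)
have -> : pairs q.+2 (2 * q.+1).+1 = 1 by rewrite /pairs; lia.
have -> : pairs q.+2 (2 * q.+1).+2 = 1 by rewrite /pairs; lia.
rewrite subnn /= !addn0.
(* Enlarging {1, ..., q + 1} by q + 2 creates one new pair, (t - q - 2, q + 2), for each t >= q + 3
   in this range. *)
rewrite (eq_big_nat _ _ (F2 := fun t => (pairs q.+1 t - 1) + (q.+3 <= t))).
  rewrite big_split /= IHq [X in _ + X](big_cat_nat (n := q.+3)) /=; try lia.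
  rewrite [X in _ + (X + _)]big_nat big1 => [|t]; last lia.
  rewrite (eq_big_nat _ _ (F2 := fun=> 1)) => [|t /andP[-> _] //].
  by rewrite sum_nat_const_nat; nia.
by move=> t tq; rewrite /pairs; lia.
Qed.

(** The window of t is left open: the bound on [C] uses all of 2, ..., 2q, the bound on [T] only the
    t with at least k pairs. *)
Definition scaled_sums (q n h a m : nat) : seq nat :=
  [seq scale q n s * t | s <- iota q h, t <- iota a m].

Lemma scaled_sums_uniq (q n h a m : nat) : 0 < q ->
  N q + q + h <= n.+1 -> 2 <= a -> a + m <= (2 * q).+1 ->
  uniq (scaled_sums q n h a m).
Proof.
move=> q_gt0 le_n a2 am; apply: allpairs_uniq; rewrite ?iota_uniq //.
move=> _ _ /allpairsP[[s t] /= [sP tP ->]] /allpairsP[[s' t'] /= [s'P t'P ->]] /=.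
rewrite !mem_iota in sP tP s'P t'P => E.
by have [-> ->] : s = s' /\ t = t' by apply: scale_inj E; lia.
Qed.

Lemma scaled_sums_T (q n h a m k : nat) : 0 < q -> 0 < k ->
  N q + q + h <= n.+1 -> 2 <= a -> a + m <= (2 * q).+1 ->
  (forall t, a <= t < a + m -> k <= pairs q t) -> h * m <= T n k.
Proof.
move=> q_gt0 k_gt0 le_n a2 am kP.
have -> : h * m = size (scaled_sums q n h a m) by rewrite size_allpairs !size_iota.
apply: uniq_leq_size; first exact: scaled_sums_uniq.
move=> _ /allpairsP[[s t] /= [sP tP ->]]; rewrite !mem_iota in sP tP.
have le_k : k <= r n (scale q n s * t).
  by apply: leq_trans (kP t tP) _; apply: pairs_le_r; lia.
by rewrite !inE /= le_k andbT r_gt0_sums // (leq_trans k_gt0).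
Qed.

Theorem theorem1p3 (q n : nat) (hq : 3 <= q) (hn : N q + q <= n) :
  let h := n - N q - q + 1 in
  [/\ h * (((q - 1) * (q - 2)) %/ 2) <= C n,
      h * (2 * q - 5) <= D n,
      (forall k : nat, 2 <= k <= uphalf q -> h * (2 * q + 3 - 4 * k) <= T n k)
    & uphalf q <= mu n].
Proof.
move=> h; have q_gt0 : 0 < q by lia.
have le_n : N q + q + h <= n.+1 by rewrite /h; lia.
have T_ge k : 2 <= k <= uphalf q -> h * (2 * q + 3 - 4 * k) <= T n k.
  (* At least k pairs exist exactly for 2k <= t <= 2q + 2 - 2k, which is 2q + 3 - 4k values of t. *)
  move=> kq; apply: (@scaled_sums_T q n h (2 * k)); try lia.
  by move=> t; rewrite /pairs; lia.
split=> //.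
- pose l := scaled_sums q n h 2 (2 * q - 1).
  have l_uniq : uniq l by apply: scaled_sums_uniq; lia.
  have l_sub : {subset l <= sums n}.
    move=> _ /allpairsP[[s t] /= [sP tP ->]]; rewrite !mem_iota in sP tP.
    apply/r_gt0_sums/(leq_trans (pairs_gt0 (q := q) (t := t) _)); first lia.
    by apply: pairs_le_r; lia.
  apply: (@leq_trans (\sum_(t <- l) (r n t - 1))); last first.
    apply: (@uniq_sub_le_big _ addn leq leqnn (fun x y => leq_addr y x)) => //.
    exact: fset_uniq.
  rewrite -(sum_pairs q_gt0) big_allpairs_dep /=.
  rewrite -[X in X * _](size_iota q) -sum1_size big_distrl /=.
  rewrite big_seq [leqRHS]big_seq.
  apply: leq_sum => s; rewrite mem_iota mul1n => sP.
  by rewrite /index_iota subSS; apply: leq_sum => t _; rewrite leq_sub2r // pairs_le_r //; lia.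
- have := T_ge 2; rewrite /D /T (_ : 2 * q + 3 - 4 * 2 = 2 * q - 5); last lia.
  by apply; lia.
(* The sum t = q + 1 has the most pairs: x runs from 1 to (q + 1)/2, rounded down. *)
- have le_r : uphalf q <= r n (scale q n q * q.+1).
    apply: leq_trans (pairs_le_r q.+1 q_gt0 hn); rewrite /pairs; lia.
  apply: (leq_trans le_r); apply: leq_bigmax_seq => //.
  by apply: r_gt0_sums; lia.
Qed.
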